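(* Let $k\ge1$ be fixed and let $\boldsymbol\beta=(\beta_1,\ldots,\beta_k)$ be constants with $\beta_i>0$ and $\beta_1+\cdots+\beta_k=1$. Color the vertices of $[n]$ so that the color class $V_i=\{v:c(v)=i\}$ has $|V_i|=\beta_i n$ for each $i\in[k]$. Let $\mathbf{c}=(c_1,\ldots,c_n)\in[k]^n$ be an arbitrary sequence of colors in which each color $j$ appears exactly $\beta_j n$ times. There is $K=K(\boldsymbol\beta)$ such that if $p=K\log n/n$, then with probability tending to $1$ as $n\to\infty$, the random graph $G_{n,p}$ on $[n]$ (with this vertex coloring) contains a $\mathbf{c}$-colored Hamilton cycle.
   Context: $G_{n,p}$ is the random graph on vertex set $[n]$ in which each of the $\binom n2$ possible edges is present independently with probability $p$. A Hamilton cycle $H=(x_1,x_2,\ldots,x_n,x_1)$, viewed as a sequence of vertices, is $\mathbf{c}$-colored if $c(x_i)=c_i$ for $i=1,\ldots,n$. *)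

(* Defs.v *)
From mathcomp Require Import all_boot all_order all_algebra.
From mathcomp Require Import reals.

Set Implicit Arguments.
Unset Strict Implicit.
Unset Printing Implicit Defensive.

Import Order.TTheory GRing.Theory Num.Theory.
Local Open Scope ring_scope.

(* A simple graph on the vertex set 'I_n is given by its set
   of edges E, a subset of [all_edges n]. *)
Definition all_edges (n : nat) : {set {set 'I_n}} := [set e : {set 'I_n} | #|e| == 2%N].

Definition adj (n : nat) (E : {set {set 'I_n}}) : rel 'I_n :=
  fun u v => [set u; v] \in E.

(* Probability that G_{n,p} has exactly the edge set E: by independence, one
   factor per potential edge.  Meaningful for 0 <= p <= 1. *)
Definition gnp_mass (R : realType) (n : nat) (p : R) (E : {set {set 'I_n}}) : R :=
  \prod_(e in all_edges n) (if e \in E then p else 1 - p).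

Definition gnp_prob (R : realType) (n : nat) (p : R)
    (P : pred {set {set 'I_n}}) : R :=
  \sum_(E in powerset (all_edges n) | P E) gnp_mass p E.

Definition color_class (n k : nat) (col : 'I_n -> 'I_k) (i : 'I_k) : {set 'I_n} :=
  [set v | col v == i].

(* [ucycleb (adj E) x] says that x is duplicate-free and that cyclically
   consecutive entries are adjacent; x having size n, it visits every vertex.
   The bound 2 < n excludes the degenerate closed walks on at most 2 vertices. *)
Definition hamilton_cycle (n : nat) (E : {set {set 'I_n}}) (x : n.-tuple 'I_n) : bool :=
  (2 < n)%N && ucycleb (adj E) x.

Definition colored_by (n k : nat) (col : 'I_n -> 'I_k) (c : n.-tuple 'I_k)
    (x : n.-tuple 'I_n) : bool :=
  [forall i : 'I_n, col (tnth x i) == tnth c i].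

Definition has_colored_hamilton_cycle (n k : nat) (col : 'I_n -> 'I_k)
    (c : n.-tuple 'I_k) : pred {set {set 'I_n}} :=
  fun E => [exists x : n.-tuple 'I_n, hamilton_cycle E x && colored_by col c x].

(* Main.v *)
Require Import Defs.
From mathcomp Require Import all_boot all_order all_algebra all_fingroup.
From mathcomp Require Import ring lra zify.
From mathcomp Require Import reals sequences exp.

(* Call a placement a bijection from vertices to cyclic positions that puts
   every vertex on a position of its own colour; each placement traces a
   [c]-colored Hamilton cycle.  A uniformly random placement traces all edges of
   a fixed set [U] with probability at most [(C / n) ^ #|U|], so the family of
   colored Hamilton cycles is spread, and the threshold follows from the
   minimum-fragment argument for spread families (Park--Pham): expose [G_{n,p}]
   in about [log2 n] rounds; given the edges [W] already exposed, replace each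
   member [F w] of the family by its smallest remainder [F v :\: W] over members
   [F v] inside [W :|: F w].  This remainder [T] lies in a set determined by
   [W :|: T] alone, so a union bound shows that in each round nearly all
   remainders shrink by a factor two.  All rounds but boundedly many have a
   fixed intensity and together account for [O(log n / n)]; the last rounds, where
   the remainders are bounded, get a larger constant intensity, which makes the
   failure probability arbitrarily small. *)

Set Implicit Arguments.
Unset Strict Implicit.
Unset Printing Implicit Defensive.

Import Order.TTheory GRing.Theory Num.Theory.
Local Open Scope ring_scope.

(** * Random subsets of a finite set *)

(** The law of a random set with independent points. Rates depend on the point so that [rate_on] can
    give rate 0 to vertex sets that are not edges. *)
Definition pmass (R : realFieldType) (X : finType) (P : X -> R) (W : {set X}) : R :=
  \prod_x (if x \in W then P x else 1 - P x).

Definition pexp (R : realFieldType) (X : finType) (P : X -> R) (f : {set X} -> R) : R :=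
  \sum_(W : {set X}) pmass P W * f W.

Section Measure.
Variables (R : realFieldType) (X : finType).
Implicit Types (P Q : X -> R) (W : {set X}) (f g : {set X} -> R).

Lemma pmass_ge0 P W : (forall x, 0 <= P x <= 1) -> 0 <= pmass P W.
Proof.
move=> P01; apply: prodr_ge0 => x _; case: ifP => _; have /andP[] := P01 x => //.
by rewrite subr_ge0.
Qed.

Lemma sum_pmass P : \sum_W pmass P W = 1.
Proof.
by rewrite /pmass -bigA_distr big1 // => x _; rewrite /= addrC subrK.
Qed.

Lemma ler_pexp P f g : (forall x, 0 <= P x <= 1) -> (forall W, f W <= g W) ->
  pexp P f <= pexp P g.
Proof.
by move=> P01 fg; apply: ler_sum => W _; apply: ler_wpM2l => //; apply: pmass_ge0.
Qed.

Lemma pexp_const P a : pexp P (fun=> a) = a.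
Proof. by rewrite /pexp -mulr_suml sum_pmass mul1r. Qed.

(** The union of two independent random sets again has independent points, and misses [x] with
    probability [(1 - P x) * (1 - Q x)]. *)
Lemma pexp_setU P Q f :
  pexp P (fun W1 => pexp Q (fun W2 => f (W1 :|: W2))) =
  pexp (fun x => 1 - (1 - P x) * (1 - Q x)) f.
Proof.
rewrite /pexp; under eq_bigr => W1 _ do rewrite mulr_sumr.
pose w (ab : bool * bool) x :=
  (if ab.1 then P x else 1 - P x) * (if ab.2 then Q x else 1 - Q x).
pose U (h : {ffun X -> bool * bool}) := [set x | (h x).1 || (h x).2].
pose pr (h : {ffun X -> bool * bool}) := ([set x | (h x).1], [set x | (h x).2]).
have prK : bijective pr.
  exists (fun Ws : {set X} * {set X} => [ffun x => (x \in Ws.1, x \in Ws.2)]) => [h | [W1 W2]].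
    by apply/ffunP => x; rewrite !ffunE !inE -surjective_pairing.
  by congr pair; apply/setP => x; rewrite !inE ffunE.
rewrite pair_bigA (reindex pr) /=; last exact: onW_bij.
transitivity (\sum_(h : {ffun X -> bool * bool}) (\prod_x w (h x) x) * f (U h)).
  apply: eq_bigr => h _; rewrite mulrA -big_split; congr (_ * f _).
    by apply: eq_bigr => x _; rewrite !inE.
  by apply/setP => x; rewrite !inE.
rewrite (partition_big U xpredT) //=; apply: eq_bigr => W _.
under eq_bigr => h /eqP -> do [].
rewrite -mulr_suml; congr (_ * _).
(* With the condition that the union is [W] moved into each factor, the sum over [h] splits into a
   product of sums, one per point. *)
transitivity (\sum_(h : {ffun X -> bool * bool})
    \prod_x (if ((h x).1 || (h x).2) == (x \in W) then w (h x) x else 0)).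
  rewrite big_mkcond; apply: eq_bigr => h _; case: eqP => [<- | UW].
    by apply: eq_bigr => x _; rewrite inE eqxx.
  have [x] : exists x, ((h x).1 || (h x).2) != (x \in W).
    apply/existsP; rewrite -negb_forall; apply/negP => /forallP hW; case: UW.
    by apply/setP => x; rewrite inE; apply/eqP.
  by move=> /negPf hx; rewrite (bigD1 x) //= hx mul0r.
rewrite -(bigA_distr_bigA (fun x (ab : bool * bool) =>
  if (ab.1 || ab.2) == (x \in W) then w ab x else 0)).
apply: eq_bigr => x _.
pose u a b := if (a || b) == (x \in W) then w (a, b) x else 0.
rewrite (eq_bigr (fun ab => u ab.1 ab.2)); last by case.
rewrite -(pair_bigA _ u) /= /u.
rewrite !big_bool /w /=; case: (x \in W) => /=; ring.
Qed.

Definition rate_on (D : {set X}) (p : R) (x : X) : R := if x \in D then p else 0.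

Lemma rate_on_prob (D : {set X}) p : 0 <= p <= 1 -> forall x, 0 <= rate_on D p x <= 1.
Proof. by move=> p01 x; rewrite /rate_on; case: ifP => // _; rewrite lexx ler01. Qed.

Lemma eq_pexp P Q f : P =1 Q -> pexp P f = pexp Q f.
Proof.
move=> PQ; apply: eq_bigr => W _; congr (_ * _).
by apply: eq_bigr => x _; rewrite PQ.
Qed.

Lemma pexp_on_setU (D : {set X}) p q f :
  pexp (rate_on D p) (fun W1 => pexp (rate_on D q) (fun W2 => f (W1 :|: W2))) =
  pexp (rate_on D (p + q - p * q)) f.
Proof. by rewrite pexp_setU; apply: eq_pexp => x; rewrite /rate_on; case: ifP => _; ring. Qed.

(** For [p != 1], a random set of rate [q] is one of rate [p] joined with an independent one of rate
    [r], where [p + r - p * r = q]; the added points can only lower [f]. *)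
Lemma pexp_on_decr (D : {set X}) p q f : 0 <= p -> p <= q -> q <= 1 ->
  (forall W1 W2, f (W1 :|: W2) <= f W1) -> pexp (rate_on D q) f <= pexp (rate_on D p) f.
Proof.
move=> p0 pq q1 fU; have [p1 | p1] := eqVneq p 1.
  by have -> : q = p by lra.
have p'0 : 0 < 1 - p by rewrite subr_gt0 lt_neqAle p1 (le_trans pq).
pose r := (q - p) / (1 - p).
have -> : q = p + r - p * r by rewrite /r; field; rewrite gt_eqF.
have r01 : 0 <= r <= 1.
  by apply/andP; split; [apply: divr_ge0; lra | rewrite /r ler_pdivrMr //; lra].
rewrite -pexp_on_setU; apply: ler_pexp => [|W1]; first by apply: rate_on_prob; lra.
by rewrite -[leRHS](pexp_const (rate_on D r)); apply: ler_pexp => //; exact: rate_on_prob.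
Qed.

Lemma pexp_on_sprinkle (D : {set X}) p q r f : 0 <= p -> 0 <= q -> p + q <= r -> r <= 1 ->
  (forall W1 W2, f (W1 :|: W2) <= f W1) ->
  pexp (rate_on D r) f <=
    pexp (rate_on D p) (fun W1 => pexp (rate_on D q) (fun W2 => f (W1 :|: W2))).
Proof. by move=> p0 q0 pqr r1 fU; rewrite pexp_on_setU; apply: pexp_on_decr => //; nra. Qed.

(** At each point of [T] a factor at most 1 turns into one at least [p]. This is the price of
    trading [W] for [W :|: T] in the union bound. *)
Lemma pmass_setU P W (T : {set X}) p : (forall x, 0 <= P x <= 1) -> 0 <= p ->
  (forall x, x \in T -> p <= P x) -> [disjoint W & T] ->
  pmass P W * p ^+ #|T| <= pmass P (W :|: T).
Proof.
move=> P01 p0 pP WT.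
rewrite -prodr_const big_mkcond /= -big_split; apply: ler_prod => x _ /=.
have /andP[P0 P1] := P01 x; rewrite !inE.
have [xT | xT] := boolP (x \in T); last first.
  by rewrite orbF mulr1 lexx andbT; case: ifP => _ //; rewrite subr_ge0.
rewrite orbT (disjointFl WT) //; have := pP _ xT => pPx.
apply/andP; split; nra.
Qed.

End Measure.

(** * Spread families *)

Section Fragments.
Variables (X I : finType).
Implicit Types (A : {set I}) (F : I -> {set X}) (W : {set X}).

Definition frag A F W (w : I) : {set X} :=
  F [arg min_(v < w | (v \in A) && (F v \subset W :|: F w)) #|F v :\: W|] :\: W.

Lemma fragP A F W w : w \in A ->
  exists2 v, v \in A & [/\ F v \subset W :|: F w, frag A F W w = F v :\: W &
    forall u, u \in A -> F u \subset W :|: F w -> (#|frag A F W w| <= #|F u :\: W|)%N].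
Proof.
move=> wA; rewrite /frag; case: arg_minnP => [|v /andP[vA vF] vmin].
  by rewrite wA subsetUr.
by exists v => //; split=> // u uA uF; apply: vmin; rewrite uA.
Qed.

Lemma frag_sub A F W w : w \in A -> frag A F W w \subset F w.
Proof. by move=> wA; have [v _ [vF -> _]] := fragP F W wA; rewrite subDset. Qed.

Lemma frag_disjoint A F W w : [disjoint W & frag A F W w].
Proof.
by rewrite disjoint_sym; have := subxx (frag A F W w); rewrite {2}/frag subsetD => /andP[].
Qed.

(** The choice of the member depends on [Z] alone, which leaves at most [2 ^ #|inner A F Z|]
    possible fragments once the union [Z] is known. *)
Definition inner A F (Z : {set X}) : {set X} :=
  if [pick w in A | F w \subset Z] is Some w then F w else set0.

(* Minimality makes the fragment a subset of a set that depends only on the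
   union of [W] with the fragment. *)
Lemma frag_sub_inner A F W w : w \in A ->
  frag A F W w \subset inner A F (W :|: frag A F W w).
Proof.
move=> wA; have Tw := frag_sub F W wA.
have [v vA [vF Tv Tmin]] := fragP F W wA.
rewrite /inner; case: pickP => [u /andP[uA uF] | /(_ v)]; last first.
  by rewrite vA Tv -subDset subxx.
have uT : F u :\: W \subset frag A F W w by rewrite subDset.
have /eqP <- : F u :\: W == frag A F W w.
  rewrite eqEcard uT Tmin //; apply: subset_trans uF _.
  by apply: setUS.
exact: subsetDl.
Qed.

Lemma inner_card A F l Z : (forall w, w \in A -> #|F w| <= l)%N -> (#|inner A F Z| <= l)%N.
Proof.
move=> Fl; rewrite /inner; case: pickP => [w /andP[wA _] | _]; first exact: Fl.
by rewrite cards0.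
Qed.

End Fragments.

(** * Covering a member of a spread family in rounds *)

Section Spread.
Variables (R : realFieldType) (X I : finType).
Implicit Types (A : {set I}) (F : I -> {set X}) (W : {set X}) (M rho : R).

(** [M] stands for the size of the original family; keeping it separate from [#|A|] lets the
    condition pass to subfamilies and to fragments. *)
Definition spread A F M rho :=
  forall U : {set X}, #|[set w in A | U \subset F w]|%:R <= M * rho ^+ #|U|.

Lemma spread_frag A F M rho W (B : {set I}) : B \subset A -> spread A F M rho ->
  spread B (frag A F W) M rho.
Proof.
move=> BA sp U; apply: le_trans (sp U); rewrite ler_nat; apply: subset_leq_card.
apply/subsetP => w; rewrite !inE => /andP[wB Uw]; have wA := subsetP BA _ wB.
by rewrite wA (subset_trans Uw) ?frag_sub.
Qed.

(** Union bound over the possible fragments [T], with [W] traded for [Z = W :|: T]. The trade costs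
    [p ^- #|T|], at most [M * rho ^+ #|T|] indices have a member containing [T], and each [Z] allows
    at most [2 ^ l] sets [T], all inside [inner A F Z]. *)
Lemma large_fragments (P : X -> R) A F M rho p l t :
  (forall x, 0 <= P x <= 1) -> 0 < p -> 0 <= rho -> rho <= p -> 
  (forall w x, w \in A -> x \in F w -> p <= P x) ->
  (forall w, w \in A -> #|F w| <= l)%N -> spread A F M rho ->
  pexp P (fun W : {set X} => #|[set w in A | t <= #|frag A F W w|]%N|%:R)
    <= M * (2 ^+ l * (rho / p) ^+ t).
Proof.
move=> P01 p0 r0 rp pP Fl sp.
have M0 : 0 <= M by have := sp set0; rewrite cards0 mulr1; apply: le_trans.
pose g (T Z : {set X}) : R := pmass P Z * (T \subset inner A F Z)%:R.
have g0 T Z : 0 <= g T Z by rewrite mulr_ge0 ?pmass_ge0.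
have step1 : pexp P (fun W : {set X} => #|[set w in A | t <= #|frag A F W w|]%N|%:R) <=
  \sum_(W : {set X}) \sum_(w in A)
    \sum_(T : {set X} | [&& (t <= #|T|)%N, T \subset F w & [disjoint W & T]])
      p ^- #|T| * g T (W :|: T).
  apply: ler_sum => W _; rewrite -sum1_card natr_sum mulr_sumr.
  rewrite (eq_bigl (fun w => (w \in A) && (t <= #|frag A F W w|)%N)); last first.
    by move=> w; rewrite inE.
  rewrite big_mkcondr; apply: ler_sum => w wA; case: ifP => [tT | _]; last first.
    by apply: sumr_ge0 => T _; rewrite mulr_ge0 // invr_ge0 exprn_ge0 // ltW.
  rewrite (bigD1 (frag A F W w)) /=; last by rewrite tT frag_sub ?frag_disjoint.
  rewrite mulr1 -[leLHS]addr0 lerD //; last first.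
    by apply: sumr_ge0 => T _; rewrite mulr_ge0 // invr_ge0 exprn_ge0 // ltW.
  rewrite /g frag_sub_inner // mulr1 mulrC ler_pdivlMr ?exprn_gt0 //.
  apply: pmass_setU => //; [exact: ltW | | exact: frag_disjoint].
  by move=> x xT; apply: (pP w) => //; apply: (subsetP (frag_sub F W wA)).
apply: le_trans step1 _.
rewrite (eq_bigr (fun W : {set X} => \sum_(T : {set X} | (t <= #|T|)%N)
   \sum_(w in A | T \subset F w)
   [disjoint W & T]%:R * (p ^- #|T| * g T (W :|: T)))); last first.
  move=> W _; rewrite (exchange_big_dep (fun T : {set X} => t <= #|T|)%N) /=; last first.
    by move=> w T _ /and3P[].
  apply: eq_bigr => T tT; rewrite [RHS]big_mkcondr [LHS]big_mkcondr /=.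
  apply: eq_bigr => w wA; rewrite tT /=; case: (T \subset F w) => //=.
  by case: [disjoint W & T]; rewrite ?mul1r ?mul0r.
rewrite exchange_big /=.
have step2 : forall T : {set X}, (t <= #|T|)%N ->
  \sum_(W : {set X}) \sum_(w in A | T \subset F w) [disjoint W & T]%:R * (p ^- #|T| * g T (W :|: T))
  <= M * (rho / p) ^+ t * \sum_(Z : {set X}) g T Z.
  move=> T tT; rewrite exchange_big /= sumr_const -mulr_natl.
  set N := #|_|; have {N}-> : N = #|[set w in A | T \subset F w]|.
    by apply: eq_card => w; rewrite !inE.
  have gT : \sum_(W : {set X}) [disjoint W & T]%:R * (p ^- #|T| * g T (W :|: T)) <=
     p ^- #|T| * \sum_(Z : {set X}) g T Z.
    rewrite mulr_sumr (eq_bigr (fun W : {set X} =>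
      if [disjoint W & T] then p ^- #|T| * g T (W :|: T) else 0)); last first.
      by move=> W _; case: [disjoint W & T]; rewrite ?mul1r ?mul0r.
    rewrite -big_mkcond [leRHS](bigID (fun Z : {set X} => T \subset Z)) /=.
    rewrite -[leLHS]addr0 lerD //; last first.
      by apply: sumr_ge0 => Z _; rewrite mulr_ge0 // invr_ge0 exprn_ge0 // ltW.
    (* Sets [W] disjoint from [T] correspond to sets [Z] containing [T]. *)
    rewrite [leRHS](reindex_onto (fun W : {set X} => W :|: T)
      (fun Z : {set X} => Z :\: T)) /=; last first.
      by by move=> Z TZ; rewrite -[RHS](setID Z T) setUC (setIidPr TZ).
    rewrite [leRHS](eq_bigl (fun W : {set X} => [disjoint W & T])) // => W; rewrite subsetUr /=.
    by rewrite setDUl setDv setU0; apply/eqP/setDidPl.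
  apply: le_trans (ler_wpM2l _ gT) _ => //.
  rewrite mulrA ler_wpM2r ?sumr_ge0 //.
  apply: le_trans (_ : M * (rho / p) ^+ #|T| <= _).
    rewrite expr_div_n mulrA ler_wpM2r ?invr_ge0 ?exprn_ge0 // ltW //.
  (* Since [rho <= p], the smallest size [t] is the worst case. *)
  apply: ler_wpM2l => //; apply: ler_wiXn2l => //; first by rewrite divr_ge0 // ltW.
  by rewrite ler_pdivrMr ?mul1r.
apply: le_trans (ler_sum _ step2) _.
rewrite -mulr_sumr -mulrA ler_wpM2l // mulrC ler_wpM2r //.
  by apply: exprn_ge0; apply: divr_ge0; lra.
rewrite exchange_big /=.
apply: le_trans (_ : \sum_(Z : {set X}) pmass P Z * 2 ^+ l <= _); last first.
  by rewrite -mulr_suml sum_pmass mul1r.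
apply: ler_sum => Z _; rewrite -mulr_sumr ler_wpM2l ?pmass_ge0 // -natr_sum.
rewrite -natrX ler_nat.
apply: leq_trans (_ : 2 ^ #|inner A F Z| <= _)%N; last by rewrite leq_exp2l ?inner_card.
rewrite -card_powerset -sum1_card big_mkcond [leqRHS]big_mkcond /= leq_sum // => T _.
by rewrite inE; case: (t <= #|T|)%N; case: (T \subset inner A F Z).
Qed.

Definition uncovered A F W : bool := [forall w in A, ~~ (F w \subset W)].

Lemma uncoveredU A F W1 W2 : uncovered A F (W1 :|: W2) -> uncovered A F W1.
Proof.
move=> /forall_inP un; apply/forall_inP => w wA; apply: contra (un w wA) => Fw.
exact: subset_trans Fw (subsetUl _ _).
Qed.

(** A fragment inside [W2] is the remainder of some member inside [W1 :|: W2]. *)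
Lemma uncovered_frag A F (B : {set I}) W1 W2 : B \subset A ->
  uncovered A F (W1 :|: W2) -> uncovered B (frag A F W1) W2.
Proof.
move=> BA /forall_inP un; apply/forall_inP => w wB.
have [v vA [_ -> _]] := fragP F W1 (subsetP BA _ wB).
by rewrite subDset; apply: un.
Qed.

(** Induction on [m]. Round [m], of rate [L m * rho], is exposed first; indices with a fragment of
    size at least [2 ^ m] are given up, the others continue with their fragments. The factor [#|A|]
    makes the bound additive over this split, while [M] stays fixed. *)
Theorem spread_uncovered (D : {set X}) M rho (L : nat -> R) m :
  0 < rho -> (forall i, 1 <= L i) -> forall A F p,
  (forall w, w \in A -> F w \subset D) -> (forall w, w \in A -> #|F w| < 2 ^ m)%N ->
  spread A F M rho -> (\sum_(i < m) L i) * rho <= p -> p <= 1 ->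
  #|A|%:R * pexp (rate_on D p) (fun W : {set X} => (uncovered A F W)%:R)
    <= M * \sum_(i < m) (4 / L i) ^+ (2 ^ i).
Proof.
move=> rho0 L1; elim: m => [|m IHm] A F p FD Fm sp Lp p1.
  (* Sizes below [2 ^ 0] mean empty members, which every [W] covers. *)
  rewrite big_ord0 mulr0; have [-> | [w wA]] := set_0Vmem A.
    by rewrite cards0 mul0r.
  rewrite /pexp big1 ?mulr0 // => W _.
  case: (boolP (uncovered A F W)) => [/forall_inP/(_ w wA) | _]; last exact: mulr0.
  have := Fm w wA; rewrite ltnS leqn0 cards_eq0 => /eqP ->.
  by rewrite sub0set.
have M0 : 0 <= M by have := sp set0; rewrite cards0 mulr1; apply: le_trans.
have L0 i : 0 < L i by apply: lt_le_trans (L1 i).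
move: Lp; rewrite big_ord_recr /= mulrDl; set p' := _ * rho; set q := _ * rho => p'q.
have q0 : 0 < q by apply: mulr_gt0.
have p'0 : 0 <= p' by apply: mulr_ge0 (ltW rho0); apply: sumr_ge0 => i _; apply: ltW.
have qP : forall x, 0 <= rate_on D q x <= 1 by apply: rate_on_prob; lra.
pose B W := [set w in A | ~~ (2 ^ m <= #|frag A F W w|)%N].
have BA W : B W \subset A by apply/subsetP => w; rewrite inE => /andP[].
pose bad W : R := #|[set w in A | 2 ^ m <= #|frag A F W w|]%N|%:R.
pose S := \sum_(i < m) (4 / L i) ^+ (2 ^ i); rewrite -/S in IHm.
have sprinkle : pexp (rate_on D p) (fun W : {set X} => (uncovered A F W)%:R : R) <=
    pexp (rate_on D q) (fun W1 : {set X} =>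
      pexp (rate_on D p') (fun W2 : {set X} => (uncovered A F (W1 :|: W2))%:R)).
  apply: pexp_on_sprinkle => //; [exact: ltW | by rewrite addrC |].
  move=> W1 W2; rewrite ler_nat.
  by case: (boolP (uncovered A F (W1 :|: W2))) => // /uncoveredU ->.
apply: le_trans (ler_wpM2l _ sprinkle) _ => //.
have -> : forall a f, a * pexp (rate_on D q) f = pexp (rate_on D q) (fun W : {set X} => a * f W).
  by move=> a f; rewrite /pexp mulr_sumr; apply: eq_bigr => W _; rewrite mulrCA.
apply: le_trans (_ : pexp (rate_on D q) (fun W : {set X} => bad W + M * S) <= _); last first.
  have -> : pexp (rate_on D q) (fun W : {set X} => bad W + M * S) = pexp (rate_on D q) bad + M * S.
    rewrite -[in RHS](pexp_const (rate_on D q) (M * S)) /pexp -big_split.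
    by apply: eq_bigr => W _; rewrite mulrDr.
  rewrite big_ord_recr /= -/S mulrDr addrC lerD2l.
  apply: le_trans (large_fragments (2 ^ m) qP q0 (ltW rho0) _ _ _ sp (l := 2 ^ m.+1)) _.
  - by rewrite ler_peMl // ltW.
  - by move=> w x wA xF; rewrite /rate_on (subsetP (FD w wA)).
  - by move=> w wA; rewrite ltnW ?Fm.
  have -> : rho / q = (L m)^-1 by rewrite /q; field; rewrite !gt_eqF.
  (* The value is [2 ^ (2 * 2 ^ m) / L m ^ (2 ^ m) = (4 / L m) ^ (2 ^ m)]. *)
  by rewrite expnS exprM -exprMn -natrX.
apply: ler_pexp => // W.
have -> : #|A|%:R = bad W + #|B W|%:R.
  rewrite -natrD -(cardsID [set w | 2 ^ m <= #|frag A F W w|]%N A); congr (_ + _)%:R.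
    by apply: eq_card => w; rewrite !inE.
  by apply: eq_card => w; rewrite !inE andbC.
have p'P : forall x, 0 <= rate_on D p' x <= 1 by apply: rate_on_prob; lra.
rewrite mulrDl lerD //.
  rewrite ler_piMr // -[leRHS](pexp_const (rate_on D p')); apply: ler_pexp => // W2.
  by rewrite lern1 leq_b1.
apply: le_trans (IHm (B W) (frag A F W) p' _ _ _ _ _) => //.
- apply: ler_wpM2l => //; apply: ler_pexp => // W2; rewrite ler_nat.
  by case: (boolP (uncovered A F _)) => // /(uncovered_frag (BA W)) ->.
- move=> w wB; have wA := subsetP (BA W) _ wB.
  exact: subset_trans (frag_sub F W wA) (FD w wA).
- by move=> w; rewrite inE ltnNge => /andP[].
- exact: spread_frag.
- lra.
Qed.

End Spread.

(** * Colored Hamilton cycles form a spread family *)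

Lemma card_fibers (R : realFieldType) (T S : finType) (A : {set T}) (f : T -> S)
    (B : {pred S}) (b : R) :
  (forall a, a \in A -> f a \in B) ->
  (forall s, s \in B -> #|[set a in A | f a == s]|%:R <= b) ->
  #|A|%:R <= #|B|%:R * b.
Proof.
move=> fB fb; rewrite -sum1_card (partition_big f [pred s in B]) //= natr_sum.
rewrite mulr_natl -sumr_const; apply: ler_sum => s sB; apply: (le_trans _ (fb s sB)).
by rewrite ler_nat -sum1_card; apply/eq_leq/eq_bigl => a; rewrite inE.
Qed.

Lemma expR1_ge1 (R : realType) : 1 <= expR 1 :> R.
Proof. by rewrite (le_trans _ (expR_ge1Dx _)) // lerDl. Qed.

(** For [m > 0], [(1 + 1 / m) ^ d <= exp (d / m) <= e]. *)
Lemma exprS_le_expR (R : realType) (m d : nat) : (d <= m)%N ->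
  m.+1%:R ^+ d <= expR 1 * m%:R ^+ d :> R.
Proof.
case: m => [|m] dm.
  by move: dm; rewrite leqn0 => /eqP ->; rewrite !expr0 mulr1 expR1_ge1.
have m0 : 0 < m.+1%:R :> R by rewrite ltr0n.
have -> : m.+2%:R = (1 + m.+1%:R^-1) * m.+1%:R :> R.
  by rewrite mulrDl mul1r mulVf ?gt_eqF // -natr1 addrC.
rewrite exprMn ler_wpM2r ?exprn_ge0 //.
apply: (@le_trans _ _ (expR m.+1%:R^-1 ^+ d)).
  by apply: lerXn2r; rewrite ?nnegrE ?expR_ge0 ?expR_ge1Dx // addr_ge0 // invr_ge0 ltW.
rewrite -expRM_natr ler_expR mulrC ler_pdivrMr // mul1r ler_nat //.
Qed.

(** Going from [m ^_ d] to [m.+1 ^_ d.+1] multiplies by [m.+1]; replacing [m ^ d] by [m.+1 ^ d]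
    costs at most one factor [e]. *)
Lemma ffact_ge (R : realType) (m d : nat) : (d <= m)%N ->
  (m%:R / expR 1) ^+ d <= (m ^_ d)%:R :> R.
Proof.
have e0 : 0 < expR 1 :> R by exact: expR_gt0.
elim: d m => [|d IHd] [|m] // dm; rewrite ?expr0 ?ffactn0 //.
rewrite ffactSS natrM; have := IHd m dm; rewrite !expr_div_n.
rewrite ler_pdivrMr ?exprn_gt0 // => md.
rewrite ler_pdivrMr ?exprn_gt0 // [leLHS]exprS -mulrA ler_wpM2l ?ler0n //.
apply: (le_trans (exprS_le_expR R (dm : (d <= m)%N))).
by rewrite exprS mulrCA ler_wpM2l // ltW.
Qed.

(** Used with [s = #|U|], [u = #|cover U|], [x = n] and [q = e / b]: the powers of [x] combine to
    [x ^- s], and [q ^ u <= q ^ (2 * s)]. *)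
Lemma spread_constant (R : realFieldType) (N q x : R) (s u : nat) :
  0 <= N -> 1 <= q -> 0 < x -> (s <= u <= 2 * s)%N ->
  2 ^+ s * (2 ^+ s * (x ^+ (u - s) * (N * (q / x) ^+ u))) <= N * (4 * q ^+ 2 / x) ^+ s.
Proof.
move=> N0 q1 x0 /andP[su us].
have [xu0 xs0] : x ^+ u != 0 /\ x ^+ s != 0 by split; rewrite expf_neq0 // gt_eqF.
have xus : x ^+ (u - s) * x ^+ s = x ^+ u by rewrite -exprD subnK.
have -> : (4 * q ^+ 2 / x) ^+ s = 4 ^+ s / x ^+ s * q ^+ (2 * s).
  by rewrite (exprMn _ (4 * _)) (exprMn _ 4) exprVn -exprM mulrAC.
have -> : 4 = 2 * 2 :> R by rewrite -natrM.
rewrite expr_div_n (exprMn _ 2 2).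
have -> : 2 ^+ s * (2 ^+ s * (x ^+ (u - s) * (N * (q ^+ u / x ^+ u)))) =
   N * (2 ^+ s * 2 ^+ s / x ^+ s * q ^+ u).
  rewrite -xus; move: (x ^+ (u - s)) (x ^+ s) (2 ^+ s) (q ^+ u) xs0 xus => X Y a Q Y0 E.
  by field; rewrite Y0 /=; apply: contraNneq xu0 => X0; rewrite -E X0 mul0r.
apply: ler_wpM2l => //; apply: ler_wpM2l; last exact: ler_weXn2l.
by rewrite divr_ge0 ?mulr_ge0 ?exprn_ge0 // ltW.
Qed.

Lemma set2_injl (T : finType) (x a b : T) : [set a; x] = [set b; x] -> a = b.
Proof.
move=> ab; have /set2P[-> // | bx] : b \in [set a; x] by rewrite ab set21.
by have /set2P[// | ->] : a \in [set b; x] by rewrite -ab set21.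
Qed.

(** * Placements with prescribed values *)

Section ColoredCycles.
Variables (n k : nat) (col : 'I_n -> 'I_k) (c : n.-tuple 'I_k).
Implicit Types (pi : {perm 'I_n}) (D : {set 'I_n}) (U : {set {set 'I_n}}).

Definition placements : {set {perm 'I_n}} :=
  [set pi : {perm 'I_n} | [forall v, tnth c (pi v) == col v]].

Lemma placementsP pi : reflect (forall v, tnth c (pi v) = col v) (pi \in placements).
Proof. by rewrite inE; apply: (iffP forallP) => h v; apply/eqP; apply: h. Qed.

Definition agreeing (pi0 : {perm 'I_n}) D : {set {perm 'I_n}} :=
  [set pi in placements | [forall v in D, pi v == pi0 v]].

Lemma agreeingP pi0 D pi :
  reflect (pi \in placements /\ forall v, v \in D -> pi v = pi0 v) (pi \in agreeing pi0 D).
Proof.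
apply: (iffP setIdP) => -[piP h]; split=> //.
  by move=> v vD; apply/eqP/(forall_inP h).
by apply/forall_inP => v vD; apply/eqP/h.
Qed.

Lemma count_color j : count_mem j c = #|[set i | tnth c i == j]|.
Proof. by rewrite -sum1_count big_tuple sum1_card -cardsE. Qed.

(** Composing with the transposition of [pi0 x] and a free position [i] of the same colour moves [x]
    to [i] and leaves the positions on [D] unchanged; distinct [i] give disjoint sets of
    placements. *)
Lemma card_agreeingU1 pi0 D x : pi0 \in placements -> x \notin D ->
  (#|agreeing pi0 (x |: D)| *
     (count_mem (col x) c - #|[set v in D | col v == col x]|) <= #|agreeing pi0 D|)%N.
Proof.
move=> pi0P xD; set j := col x.
have pi0c := placementsP _ pi0P.
pose J := [set i | tnth c i == j] :\: pi0 @: D.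
have cardJ : (count_mem j c - #|[set v in D | col v == j]| <= #|J|)%N.
  rewrite count_color.
  have <- : #|pi0 @: [set v in D | col v == j]| = #|[set v in D | col v == j]|.
    by apply: card_imset; apply: perm_inj.
  rewrite leq_subLR -[leqLHS](cardsID (pi0 @: D)) leq_add2r; apply: subset_leq_card.
  apply/subsetP => i; rewrite !inE => /andP[ij /imsetP[v vD iv]].
  by apply/imsetP; exists v => //; rewrite inE vD /= -pi0c -iv.
have fib i : i \in J ->
    (#|agreeing pi0 (x |: D)| <= #|[set pi in agreeing pi0 D | pi x == i]|)%N.
  rewrite !inE => /andP[iD /eqP ij].
  rewrite -(card_imset _ (mulIg (tperm (pi0 x) i))); apply: subset_leq_card.
  apply/subsetP => _ /imsetP[pi /agreeingP[/placementsP piP piD] ->].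
  have pix : pi x = pi0 x by apply: piD; rewrite setU11.
  rewrite in_set; apply/andP; split; last by rewrite permM pix tpermL.
  apply/agreeingP; split=> [|v vD].
    apply/placementsP => v; rewrite permM.
    case: tpermP => [pv | pv | _ _]; last exact: piP.
      by rewrite ij -(piP v) pv pi0c.
    by rewrite pi0c -(piP v) pv ij.
  rewrite permM piD ?setU1r // tpermD //.
    by apply: contraNneq xD => /perm_inj ->.
  by apply: contraNneq iD => ->; rewrite imset_f.
rewrite mulnC; apply: leq_trans (leq_mul cardJ (leqnn _)) _.
rewrite -sum_nat_const.
rewrite -[leqRHS]sum1_card (partition_big (fun pi : {perm 'I_n} => pi x) xpredT) //=.
rewrite [leqRHS](bigID [in J]) /= -[leqLHS]addn0 leq_add //.
apply: leq_sum => i iJ; apply: leq_trans (fib i iJ) _.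
by rewrite -sum1_card; apply/eq_leq/eq_bigl => pi; rewrite inE.
Qed.

(** The vertices of [D] are released one at a time; each multiplies the count by at least the number
    of positions of its colour not taken by the rest of [D]. *)
Lemma card_agreeing_ffact pi0 D : pi0 \in placements ->
  (#|agreeing pi0 D| * \prod_j (count_mem j c) ^_ #|[set v in D | col v == j]|
     <= #|placements|)%N.
Proof.
move=> pi0P; move E : #|D| => d; elim: d D E => [|d IHd] D E.
  have -> : D = set0 by apply/eqP; rewrite -cards_eq0 E.
  rewrite big1 ?muln1 => [|j _]; last first.
    rewrite (_ : [set _ in _ | _] = set0) ?cards0 ?ffactn0 //.
    by apply/setP => v; rewrite !inE.
  by apply: subset_leq_card; apply/subsetP => pi /agreeingP[].
have [x xD] : exists x, x \in D by apply/set0Pn; rewrite -cards_eq0 E.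
have xD' : x \notin D :\ x by rewrite setD11.
have := IHd (D :\ x); rewrite (cardsD1 x) xD in E.
move=> /(_ ltac:(by case: E)); apply: leq_trans.
apply: leq_trans (_ : #|agreeing pi0 (x |: D :\ x)| *
   (count_mem (col x) c - #|[set v in D :\ x | col v == col x]|) *
   \prod_j (count_mem j c) ^_ #|[set v in D :\ x | col v == j]| <= _)%N; last first.
  by rewrite leq_mul2r card_agreeingU1 ?orbT.
rewrite setD1K // -mulnA leq_mul2l; apply/orP; right.
rewrite (bigD1 (col x)) //= [X in (_ <= _ * X)%N](bigD1 (col x)) //= mulnA leq_mul //.
  rewrite [X in (_ ^_ X <= _)%N](_ : _ = #|[set v in D :\ x | col v == col x]|.+1).
    by rewrite ffactnSr mulnC.
  rewrite [LHS](cardsD1 x) !inE xD eqxx /= add1n; congr S; apply: eq_card => v.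
  by rewrite !inE; case: (v == x) => //=.
apply/eq_leq/eq_bigr => j jx; congr (_ ^_ _); apply: eq_card => v; rewrite !inE.
by have [-> | //] := eqVneq v x; rewrite [RHS]/= andbC eq_sym (negPf jx).
Qed.

Lemma card_agreeing (R : realType) (b : R) pi0 D : pi0 \in placements -> 0 < b ->
  (forall j, b <= (count_mem j c)%:R) ->
  #|agreeing pi0 D|%:R <= #|placements|%:R * (expR 1 / b) ^+ #|D|.
Proof.
move=> pi0P b0 bc; have := card_agreeing_ffact D pi0P.
rewrite -(ler_nat R) natrM natr_prod => le1.
have e0 : 0 < expR 1 :> R by exact: expR_gt0.
have be0 : 0 < b / expR 1 by exact: divr_gt0.
rewrite -[expR 1 / b]invf_div exprVn ler_pdivlMr ?exprn_gt0 ?divr_gt0 //.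
apply: (le_trans _ le1); rewrite ler_wpM2l ?ler0n //.
have -> : #|D| = (\sum_j #|[set v in D | col v == j]|)%N.
  rewrite -sum1_card (partition_big col xpredT) //=; apply: eq_bigr => j _.
  by rewrite -sum1_card; apply: eq_bigl => v; rewrite inE.
rewrite -prodrXr; apply: ler_prod => j _; rewrite exprn_ge0 ?(ltW be0) //=.
have dm : (#|[set v in D | col v == j]| <= count_mem j c)%N.
  rewrite -[leqLHS](card_imset _ (@perm_inj _ pi0)) count_color.
  apply: subset_leq_card; apply/subsetP => _ /imsetP[v + ->]; rewrite inE => /andP[_ /eqP vj].
  by rewrite !inE (placementsP _ pi0P) vj.
apply: (le_trans _ (ffact_ge R dm)).
have bm : b / expR 1 <= (count_mem j c)%:R / expR 1 by rewrite ler_wpM2r // invr_ge0 ltW.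
by apply: lerXn2r => //; rewrite nnegrE (le_trans (ltW be0)).
Qed.

(** * Cycles traced by placements *)

Definition cycle_succ pi (v : 'I_n) : 'I_n := (pi^-1)%g (ordS (pi v)).

Definition cycle_edges pi : {set {set 'I_n}} := [set [set v; cycle_succ pi v] | v : 'I_n].

Lemma cycle_succE pi v : pi (cycle_succ pi v) = ordS (pi v).
Proof. by rewrite /cycle_succ permKV. Qed.

Lemma cycle_succ_inj pi : injective (cycle_succ pi).
Proof. by move=> u v /perm_inj/ordS_inj/perm_inj. Qed.

Lemma card_cycle_edges pi : (#|cycle_edges pi| <= n)%N.
Proof. by apply: leq_trans (leq_imset_card _ _) _; rewrite card_ord. Qed.

Section Heads.
Variables (x0 : 'I_n) (U : {set {set 'I_n}}).

(** The end of [e] that comes second along the cycle. The constant value [x0] off [U] makes these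
    functions countable as a [pfamily]. *)
Definition edge_head pi : {ffun {set 'I_n} -> 'I_n} :=
  [ffun e : {set 'I_n} => if e \in U then
     cycle_succ pi (odflt x0 [pick v | e == [set v; cycle_succ pi v]]) else x0].

Definition containing : {set {perm 'I_n}} := [set pi in placements | U \subset cycle_edges pi].

Lemma edge_headP pi e : pi \in containing -> e \in U ->
  exists2 t, e = [set t; edge_head pi e] & edge_head pi e = cycle_succ pi t.
Proof.
rewrite in_set => /andP[_ UE] eU; rewrite ffunE eU.
have /imsetP[v _ ev] := subsetP UE _ eU.
by case: pickP => [t /eqP et | /(_ v)]; [exists t | rewrite -ev eqxx].
Qed.

Lemma edge_head_in pi e : pi \in containing -> e \in U -> edge_head pi e \in e.
Proof.
by move=> piU eU; have [t et _] := edge_headP piU eU; have := set22 t (edge_head pi e); rewrite -et.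
Qed.

Lemma edge_head_inj pi : pi \in containing -> {in U &, injective (edge_head pi)}.
Proof.
move=> piU e e' eU e'U hh.
have [t et ht] := edge_headP piU eU; have [t' et' ht'] := edge_headP piU e'U.
by rewrite et et' hh; congr [set _; _]; apply: (@cycle_succ_inj pi); rewrite -ht -ht' hh.
Qed.

Lemma edge_head_sub_cover pi : pi \in containing -> edge_head pi @: U \subset cover U.
Proof.
move=> piU; apply/subsetP => _ /imsetP[e eU ->].
by apply/bigcupP; exists e => //; apply: edge_head_in.
Qed.

(* The two ends of an edge across the seam have positions [n - 1] and [0], so
   the induction along the cycle in [agree_from_roots] has to know these edges. *)
Definition wrapping pi : {set {set 'I_n}} := [set e in U | val (pi (edge_head pi e)) == 0%N].

(** Induction on the position under [pi0]: a vertex of [cover U] that is not a root is the head of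
    an edge of [U], and both placements put it right after the same tail. *)
Lemma agree_from_roots pi pi0 : pi \in containing -> pi0 \in containing ->
  edge_head pi = edge_head pi0 -> wrapping pi = wrapping pi0 ->
  (forall v, v \in cover U :\: edge_head pi0 @: U -> pi v = pi0 v) ->
  forall v, v \in cover U -> pi v = pi0 v.
Proof.
move=> piU pi0U hh ww roots v; have [N] := ubnP (val (pi0 v)).
elim: N v => // N IHN v ltN vU.
have [vh | vh] := boolP (v \in edge_head pi0 @: U); last by apply: roots; rewrite inE vh.
case/imsetP: vh => e eU ve.
have [t et ht] := edge_headP pi0U eU; have [t' et' ht'] := edge_headP piU eU.
have {et'}tt' : t' = t by apply: set2_injl (_ : [set t'; v] = _); rewrite {1}ve -hh -et' et ve.
have wv : (val (pi v) == 0%N) = (val (pi0 v) == 0%N).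
  by have /setP/(_ e) := ww; rewrite !inE eU /= hh -ve.
(* At position 0 the tail has no smaller position, so the wrapping edges decide. *)
have [v0 | v0] := eqVneq (val (pi0 v)) 0%N.
  by apply: val_inj; rewrite v0; apply/eqP; rewrite wv v0.
have pi0v : pi0 v = ordS (pi0 t) by rewrite ve ht cycle_succE.
have -> : pi v = ordS (pi t) by rewrite ve -hh ht' cycle_succE tt'.
have tn : ((pi0 t).+1 < n)%N.
  rewrite ltn_neqAle ltn_ord andbT; apply: contra v0 => /eqP tn.
  by rewrite pi0v /= tn modnn.
rewrite pi0v; congr ordS; apply: IHN; last by apply/bigcupP; exists e => //; rewrite et set21.
by move: ltN; rewrite pi0v /= modn_small.
Qed.

(* A placement tracing all edges of [U] is determined on [cover U] by the head of
   each edge, the wrapping edges, and the positions of the [#|cover U| - #|U|]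
   vertices that are not a head. *)
Lemma card_containing (R : realType) (b : R) : 0 < b ->
  (forall j, b <= (count_mem j c)%:R) ->
  #|containing|%:R <= 2 ^+ #|U| * (2 ^+ #|U| *
    (n%:R ^+ (#|cover U| - #|U|) * (#|placements|%:R * (expR 1 / b) ^+ #|cover U|))).
Proof.
move=> b0 bc.
have B0 : 0 <= #|placements|%:R * (expR 1 / b) ^+ #|cover U|.
  by rewrite mulr_ge0 // exprn_ge0 // divr_ge0 ?ltW ?expR_gt0.
have C0 : 0 <= 2 ^+ #|U| * (n%:R ^+ (#|cover U| - #|U|) *
    (#|placements|%:R * (expR 1 / b) ^+ #|cover U|)).
  by do 2![apply: mulr_ge0; first exact: exprn_ge0].
have [-> | [pi1 pi1U]] := set_0Vmem containing.
  by rewrite cards0 mulr_ge0 // exprn_ge0.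
have U2 e : e \in U -> (#|e| <= 2)%N.
  by move=> eU; have [t -> _] := edge_headP pi1U eU; rewrite cards2; case: (_ != _).
have fam : #|pfamily x0 (mem U) (fun e : {set 'I_n} => mem e)|%:R <= 2 ^+ #|U| :> R.
  rewrite card_pfamily -natrX ler_nat -[#|U|](size_image id).
  rewrite /image_mem map_id; have: all [in U] (enum U) by apply/allP => e; rewrite mem_enum.
  elim: (enum U) => [|e s IHs] //= /andP[eU sU]; rewrite expnS leq_mul ?IHs //.
  exact: U2.
apply: (le_trans (card_fibers (f := edge_head)
  (B := pfamily x0 (mem U) (fun e : {set 'I_n} => mem e)) (b := 2 ^+ #|U| *
    (n%:R ^+ (#|cover U| - #|U|) * (#|placements|%:R * (expR 1 / b) ^+ #|cover U|))) _ _)).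
- move=> pi piU; apply/pfamilyP; split=> [|e eU].
    by apply/supportP => e eU; rewrite ffunE (negPf eU).
  exact: edge_head_in.
- move=> h _.
  have <- : #|powerset U|%:R = 2 ^+ #|U| :> R by rewrite card_powerset natrX.
  apply: (card_fibers (f := wrapping) (B := powerset U)).
    by move=> pi _; rewrite powersetE; apply/subsetP => e; rewrite inE => /andP[].
  move=> w _; set A := [set _ in _ | _].
  have AP pi : pi \in A -> [/\ pi \in containing, edge_head pi = h & wrapping pi = w].
    by rewrite in_set => /andP[+ /eqP ->]; rewrite in_set => /andP[-> /eqP ->].
  have [-> | [pi0 /AP[pi0U h0 w0]]] := set_0Vmem A.
    by rewrite cards0; apply: mulr_ge0 => //; apply: exprn_ge0.
  have hU : h @: U \subset cover U by rewrite -h0 edge_head_sub_cover.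
  have hcard : #|h @: U| = #|U| by rewrite -h0; apply: card_in_imset; apply: edge_head_inj.
  pose roots := cover U :\: h @: U.
  (* Distinct edges have distinct heads, so [#|cover U| - #|U|] roots remain. *)
  have <- : #|pffun_on x0 (mem roots) (@predT 'I_n)|%:R = n%:R ^+ (#|cover U| - #|U|) :> R.
    by rewrite card_pffun_on card_ord cardsD (setIidPr hU) hcard natrX.
  apply: (card_fibers (f := fun pi => [ffun v => if v \in roots then pi v else x0])).
    move=> pi _; apply/pffun_onP; split=> [|//].
    by apply/supportP => v vr; rewrite ffunE (negPf vr).
  move=> r _; set A' := [set _ in _ | _].
  have [-> | [pi2 pi2A]] := set_0Vmem A'; first by rewrite cards0.
  have /AP[pi2U h2 w2] : pi2 \in A by move: pi2A; rewrite in_set => /andP[].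
  have /eqP r2 : [ffun v => if v \in roots then pi2 v else x0] == r.
    by move: pi2A; rewrite in_set => /andP[].
  have pi2P : pi2 \in placements by move: pi2U; rewrite in_set => /andP[].
  (* Every placement in this last fiber agrees with [pi2] on all of [cover U]. *)
  apply: (le_trans _ (card_agreeing (cover U) pi2P b0 bc)).
  rewrite ler_nat; apply: subset_leq_card; apply/subsetP => pi.
  rewrite in_set => /andP[piA /eqP rpi].
  have [piU hpi wpi] := AP _ piA.
  apply/agreeingP; split; first by move: piU; rewrite in_set => /andP[].
  apply: agree_from_roots => //; rewrite ?hpi ?h2 ?wpi ?w2 // => v vr.
  by have /ffunP/(_ v) := etrans rpi (esym r2); rewrite !ffunE vr.
by rewrite ler_wpM2r.
Qed.

End Heads.

(** [card_containing] at [b * n], simplified by [#|U| <= #|cover U| <= 2 * #|U|]: heads are distinct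
    vertices, and an edge has at most two ends. *)
Lemma spread_placements (R : realType) (b : R) : (0 < n)%N -> 0 < b -> b <= 1 ->
  (forall j, b * n%:R <= (count_mem j c)%:R) ->
  spread placements cycle_edges #|placements|%:R (4 * (expR 1 / b) ^+ 2 / n%:R).
Proof.
move=> n0 b0 b1 bc U.
have n0R : 0 < n%:R :> R by rewrite ltr0n.
have eb1 : 1 <= expR 1 / b.
  by rewrite ler_pdivlMr // mul1r (le_trans b1) ?expR1_ge1.
have eb0 : 0 < expR 1 / b by apply: lt_le_trans eb1.
rewrite -[[set _ in _ | _]]/(containing U).
have [-> | [pi1 pi1U]] := set_0Vmem (containing U).
  by rewrite cards0 mulr_ge0 // exprn_ge0 // divr_ge0 // mulr_ge0 // exprn_ge0 // ltW.
have := card_containing (Ordinal n0) U (mulr_gt0 b0 n0R) bc; move/le_trans; apply.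
have Uu : (#|U| <= #|cover U|)%N.
  rewrite -(card_in_imset (edge_head_inj (x0 := Ordinal n0) pi1U)).
  exact/subset_leq_card/edge_head_sub_cover.
have u2 : (#|cover U| <= 2 * #|U|)%N.
  apply: leq_trans (_ : \sum_(e in U) #|e| <= _)%N; first by rewrite leq_card_cover.
  rewrite mulnC -sum_nat_const; apply: leq_sum => e eU.
  by have [t -> _] := edge_headP (Ordinal n0) pi1U eU; rewrite cards2; case: (_ != _).
have -> : expR 1 / (b * n%:R) = expR 1 / b / n%:R by rewrite invfM mulrA.
by apply: spread_constant => //; rewrite Uu.
Qed.

End ColoredCycles.

(** * The threshold *)

Lemma placement_exists (n k : nat) (col : 'I_n -> 'I_k) (c : n.-tuple 'I_k) :
  (forall j, #|color_class col j| = count_mem j c) -> exists pi, pi \in placements col c.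
Proof.
move=> count_eq.
have : perm_eq [seq col v | v <- enum 'I_n] c.
  apply/allP => j _; apply/eqP; rewrite -count_eq count_map -sum1_count -sum1_card big_enum_cond /=.
  by apply: eq_bigl => v; rewrite inE.
case/tuple_permP => pi /eq_in_map eq_col; exists pi; apply/placementsP => v.
by rewrite eq_col ?mem_enum.
Qed.

Lemma cycle_map_ord (n : nat) (T : Type) (e : rel T) (f : 'I_n -> T) :
  (forall i, e (f i) (f (ordS i))) -> path.cycle e [seq f i | i <- enum 'I_n].
Proof.
case: n f => [|n] f ef; first by rewrite (size0nil (size_enum_ord 0)).
have nth_f i (ltin : (i < n.+1)%N) :
    nth (f ord0) [seq f i | i <- enum 'I_n.+1] i = f (Ordinal ltin).
  rewrite (nth_map ord0) ?size_enum_ord //; congr f.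
  by apply: val_inj; rewrite /= nth_enum_ord.
have sz : size [seq f i | i <- enum 'I_n.+1] = n.+1 by rewrite size_map size_enum_ord.
case: [seq f i | i <- enum 'I_n.+1] sz nth_f => [|a p] // [sz] nth_f.
have ea : a = f ord0 by have /= -> := nth_f 0%N isT; congr f; apply: val_inj.
apply/(pathP (f ord0)) => i; rewrite size_rcons sz => ltin.
rewrite -rcons_cons nth_rcons /= sz ltin (nth_f i ltin) nth_rcons sz.
have := ef (Ordinal ltin); have [ltin' | lein] := ltnP i n.
  have /= -> := nth_f i.+1 ltin'; rewrite (_ : ordS _ = Ordinal (ltin' : (i.+1 < n.+1)%N)) //.
  by apply: val_inj; rewrite /= modn_small.
have E : i = n by apply/eqP; rewrite eqn_leq lein andbT.
rewrite {1}(introT eqP E) ea (_ : ordS _ = ord0) //.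
by apply: val_inj; rewrite /= E modnn.
Qed.

(** The inverse of a placement lists the vertices in the order of the cycle. *)
Lemma hamilton_cycle_of_placement (n k : nat) (col : 'I_n -> 'I_k) (c : n.-tuple 'I_k)
    (pi : {perm 'I_n}) (E : {set {set 'I_n}}) :
  (2 < n)%N -> pi \in placements col c -> cycle_edges pi \subset E ->
  has_colored_hamilton_cycle col c E.
Proof.
move=> n3 /placementsP pic piE; apply/existsP; exists [tuple (pi^-1)%g i | i < n].
apply/andP; split; last first.
  by apply/forallP => i; rewrite tnth_mktuple -pic permKV.
rewrite /hamilton_cycle n3 /ucycleb map_inj_uniq ?enum_uniq ?andbT; last exact: perm_inj.
apply: cycle_map_ord => i; apply: (subsetP piE); apply/imsetP; exists ((pi^-1)%g i) => //.
by rewrite /cycle_succ permKV.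
Qed.

Lemma cycle_edges_sub (n : nat) (pi : {perm 'I_n}) : (1 < n)%N ->
  cycle_edges pi \subset all_edges n.
Proof.
move=> n2; apply/subsetP => _ /imsetP[v _ ->]; rewrite inE cards2 eqSS.
suff -> : v != cycle_succ pi v by [].
apply/eqP => /(congr1 pi); rewrite cycle_succE => /(congr1 val) /=.
have := ltn_ord (pi v); rewrite leq_eqVlt => /orP[/eqP E | lt].
  by rewrite E modnn => v0; move: E n2; rewrite v0 => <-.
by rewrite modn_small //; move/eqP; rewrite ltn_eqF.
Qed.

(** A set with an element outside [all_edges n] has mass 0, as the rate there is 0. *)
Lemma gnp_prob_pexp (R : realType) (n : nat) (p : R) (Q : pred {set {set 'I_n}}) :
  gnp_prob p Q = pexp (rate_on (all_edges n) p) (fun E => (Q E)%:R).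
Proof.
rewrite /pexp (bigID [in powerset (all_edges n)]) /= [X in _ + X]big1 ?addr0.
  rewrite /gnp_prob big_mkcondr; apply: eq_bigr => E; rewrite powersetE => ED.
  have -> : pmass (rate_on (all_edges n) p) E = gnp_mass p E.
    rewrite /pmass /gnp_mass [RHS]big_mkcond; apply: eq_bigr => e _; rewrite /rate_on.
    case: (boolP (e \in all_edges n)) => // eD; rewrite ifN ?subr0 //.
    by apply: contra eD; apply: (subsetP ED).
  by case: (Q E); rewrite ?mulr1 ?mulr0.
move=> E; rewrite powersetE => /subsetPn[e eE eD].
by rewrite /pmass (bigD1 e) //= eE /rate_on (negPf eD) !mul0r.
Qed.

Lemma gnp_probC (R : realType) (n : nat) (p : R) (Q : pred {set {set 'I_n}}) :
  gnp_prob p Q = 1 - pexp (rate_on (all_edges n) p) (fun E => (~~ Q E)%:R).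
Proof.
apply/eqP; rewrite gnp_prob_pexp eq_sym subr_eq eq_sym -big_split /=.
rewrite -[X in _ == X](sum_pmass (rate_on (all_edges n) p)); apply/eqP/eq_bigr => E _.
by rewrite -mulrDr; case: (Q E); rewrite ?addr0 ?add0r mulr1.
Qed.

(** * Intensities of the rounds *)

Section Rounds.
Variable R : realType.

(* Round [i] takes members of size below [2 ^ i.+1] to size below [2 ^ i], so the
   rounds [i <= h] are the last ones exposed. *)
Definition intensity (h i : nat) : R := if (i <= h)%N then 8 * 2 ^+ h else 8.

Lemma intensity_ge1 h i : 1 <= intensity h i.
Proof.
have h1 : 1 <= 2 ^+ h :> R by apply: exprn_ege1; rewrite ler1n.
by rewrite /intensity; case: ifP => _; lra.
Qed.

Lemma sum_intensity h m :
  \sum_(i < m) intensity h i <= 8 * m%:R + h.+1%:R * (8 * 2 ^+ h).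
Proof.
have X0 : 0 <= 8 * 2 ^+ h :> R by rewrite mulr_ge0 // exprn_ge0.
have le_min : \sum_(i < m) intensity h i <= 8 * m%:R + (minn m h.+1)%:R * (8 * 2 ^+ h).
  elim: m => [|m IHm]; first by rewrite big_ord0 mulr0 min0n mul0r addr0.
  rewrite big_ord_recr /= /intensity; case: leqP => mh.
    have -> : minn m.+1 h.+1 = (minn m h.+1).+1 by lia.
    rewrite -(natr1 m) -(natr1 (minn _ _)); lra.
  have -> : minn m.+1 h.+1 = minn m h.+1 by lia.
  rewrite -(natr1 m); lra.
apply: (le_trans le_min); rewrite lerD2l ler_wpM2r // ler_nat; lia.
Qed.

(** The exponents compare by [2 ^ i >= i.+1] if [i <= h], and by [2 ^ i >= 2 * i] if [i > h]. The
    factor [2^-1 ^+ i.+1] makes the sum over the rounds geometric. *)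
Lemma intensity_failure h i : (4 / intensity h i) ^+ (2 ^ i) <= 2^-1 ^+ h * 2^-1 ^+ i.+1.
Proof.
have lt2 := ltn_expl i (isT : 1 < 2)%N.
rewrite -exprD /intensity; case: leqP => ih.
  have -> : 4 / (8 * 2 ^+ h) = 2^-1 ^+ h.+1 :> R.
    have h0 : 2 ^+ h != 0 :> R by rewrite expf_neq0 // pnatr_eq0.
    by rewrite exprVn exprS; field.
  by rewrite -exprM; apply: ler_wiXn2l; [lra | lra | nia].
have -> : 4 / 8 = 2^-1 :> R by field.
apply: ler_wiXn2l; [lra | lra |].
case: i ih {lt2} => // i ih; rewrite expnS.
have := ltn_expl i (isT : 1 < 2)%N; lia.
Qed.

Lemma sum_intensity_failure h m :
  \sum_(i < m) (4 / intensity h i) ^+ (2 ^ i) <= 2^-1 ^+ h.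
Proof.
have half0 : 0 <= 2^-1 :> R by rewrite invr_ge0.
apply: (@le_trans _ _ (2^-1 ^+ h * (1 - 2^-1 ^+ m))); last first.
  by rewrite ler_piMr ?gerBl ?(exprn_ge0 _ half0).
elim: m => [|m IHm]; first by rewrite big_ord0 expr0 subrr mulr0.
rewrite big_ord_recr /=; have := intensity_failure h m.
rewrite [2^-1 ^+ m.+1]exprS; lra.
Qed.

Lemma ln2_ge : 2^-1 <= ln 2 :> R.
Proof.
have := @le_ln1Dx R (- 2^-1) ltac:(lra).
have -> : 1 + - 2^-1 = 2^-1 :> R by field.
by rewrite lnV ?posrE //; lra.
Qed.

Lemma trunc_log_le_ln n : (0 < n)%N -> (trunc_log 2 n)%:R <= 2 * ln n%:R :> R.
Proof.
move=> n0; set t := trunc_log 2 n.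
have : ln (2 ^+ t) <= ln n%:R :> R.
  by rewrite ler_ln ?posrE ?exprn_gt0 ?ltr0n // -natrX ler_nat trunc_logP.
rewrite lnXn // -[ln 2 *+ t]mulr_natr => le_ln.
have : 2^-1 * t%:R <= ln 2 * t%:R :> R by rewrite ler_wpM2r // ln2_ge.
lra.
Qed.

(** Both terms of [ln x = ln (x / (2 * K)) + ln (2 * K)] are at most [x / (2 * K)]. *)
Lemma mul_ln_le (K x : R) : 0 < K -> 4 * K ^+ 2 <= x -> K * ln x <= x.
Proof.
move=> K0 Kx; have K20 : 0 < 2 * K by lra.
have x0 : 0 < x by apply: lt_le_trans Kx; rewrite mulr_gt0 ?exprn_gt0.
have -> : ln x = ln (x / (2 * K)) + ln (2 * K).
  by rewrite -lnM ?posrE ?divr_gt0 // divfK // gt_eqF.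
have := ln_sublinear (divr_gt0 x0 K20); have := ln_sublinear K20.
have : 2 * K <= x / (2 * K) by rewrite ler_pdivlMr //; lra.
have : K * (x / (2 * K)) = x / 2 by field; rewrite gt_eqF.
nra.
Qed.

(** The accuracy [h] adds only a constant to the total intensity, which [ln n] absorbs; so the lower
    bound on [p] does not depend on [h]. *)
Lemma gnp_prob_failure (n k h : nat) (col : 'I_n -> 'I_k) (c : n.-tuple 'I_k) (b p : R) :
  (2 < n)%N -> 0 < b -> b <= 1 ->
  (forall j, #|color_class col j| = count_mem j c) ->
  (forall j, b * n%:R <= (count_mem j c)%:R) ->
  8 + h.+1%:R * (8 * 2 ^+ h) <= ln n%:R :> R ->
  17 * (4 * (expR 1 / b) ^+ 2) * ln n%:R / n%:R <= p -> p <= 1 ->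
  1 - 2^-1 ^+ h <= gnp_prob p (has_colored_hamilton_cycle col c) <= 1.
Proof.
move=> n3 b0 b1 count_eq bc hn Cp p1.
have n0 : (0 < n)%N by apply: ltn_trans n3.
have n0R : 0 < n%:R :> R by rewrite ltr0n.
set C := 4 * (expR 1 / b) ^+ 2 in Cp.
have C0 : 0 < C by rewrite mulr_gt0 // exprn_gt0 // divr_gt0 // expR_gt0.
have ln0 : 0 <= ln n%:R :> R by rewrite ln_ge0 // ler1n.
have p01 : 0 <= p <= 1.
  rewrite p1 andbT (le_trans _ Cp) //; apply: divr_ge0 => //.
  by apply: mulr_ge0 => //; lra.
rewrite gnp_probC; set X := pexp _ _.
have X0 : 0 <= X.
  by apply: sumr_ge0 => E _; rewrite mulr_ge0 // pmass_ge0 // => e; apply: rate_on_prob.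
suff : X <= 2^-1 ^+ h by lra.
set O := placements col c.
have O0 : 0 < #|O|%:R :> R.
  by rewrite ltr0n card_gt0; apply/set0Pn; apply: placement_exists.
pose m := (trunc_log 2 n).+1.
have nm : (n < 2 ^ m)%N by apply: trunc_log_ltn.
have le1 : #|O|%:R * pexp (rate_on (all_edges n) p)
    (fun E => (uncovered O (@cycle_edges n) E)%:R) <=
    #|O|%:R * \sum_(i < m) (4 / intensity h i) ^+ (2 ^ i).
  apply: (spread_uncovered (divr_gt0 C0 n0R) (intensity_ge1 h)) => //.
  - by move=> pi _; apply: cycle_edges_sub; apply: ltn_trans n3.
  - by move=> pi _; apply: leq_ltn_trans (card_cycle_edges pi) nm.
  - exact: spread_placements.
  apply: (le_trans _ Cp).
  have -> : 17 * C * ln n%:R / n%:R = 17 * ln n%:R * (C / n%:R) by ring.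
  apply: ler_wpM2r; first by rewrite divr_ge0 // ltW.
  (* As [m <= 2 * ln n + 1], the intensities sum to at most [16 * ln n] plus
     [8 + h.+1 * (8 * 2 ^ h)], itself at most [ln n]; hence the 17. *)
  apply: (le_trans (sum_intensity h m)); have := trunc_log_le_ln n0.
  rewrite /m -(natr1 (trunc_log 2 n)); lra.
have : #|O|%:R * X <= #|O|%:R * 2^-1 ^+ h.
  apply: (@le_trans _ _ (#|O|%:R * pexp (rate_on (all_edges n) p)
      (fun E => (uncovered O (@cycle_edges n) E)%:R))).
    apply: ler_wpM2l => //; apply: ler_pexp => [|E]; first exact: rate_on_prob.
    rewrite ler_nat; case: (boolP (has_colored_hamilton_cycle col c E)) => //= noE.
    suff -> : uncovered O (@cycle_edges n) E by [].
    apply/forall_inP => pi piO; apply: contra noE; exact: hamilton_cycle_of_placement.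
  by apply: (le_trans le1); rewrite ler_wpM2l // sum_intensity_failure.
by rewrite ler_pM2l.
Qed.

End Rounds.

(* The constant and the limit *)
From mathcomp Require Import all_classical all_reals all_analysis.

Local Open Scope classical_set_scope.
Local Open Scope ring_scope.

Theorem theorem2 (R : realType) (k : nat) (beta : 'I_k -> R)
    (k_ge1 : (1 <= k)%N)
    (beta_gt0 : forall i : 'I_k, 0 < beta i)
    (beta_sum1 : \sum_(i < k) beta i = 1) :
  exists2 K : R, 0 < K &
    forall eps : R, 0 < eps ->
    \forall n \near \oo,
    forall (col : 'I_n -> 'I_k) (c : n.-tuple 'I_k),
      (forall i : 'I_k, #|color_class col i|%:R = beta i * n%:R) ->
      (forall j : 'I_k, (count_mem j c)%:R = beta j * n%:R) ->
      `| gnp_prob (K * ln n%:R / n%:R) (has_colored_hamilton_cycle col c) - 1 |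
        < eps.
Proof.
pose b := \big[Order.min/1]_j beta j.
have b0 : 0 < b by rewrite /b; elim/big_ind: _ => // x y x0 y0; rewrite lt_min x0.
have b1 : b <= 1 by exact: bigmin_le_id.
have e0 : 0 < expR 1 :> R by exact: expR_gt0.
pose K := 17 * (4 * (expR 1 / b) ^+ 2).
have K0 : 0 < K by rewrite mulr_gt0 // mulr_gt0 // exprn_gt0 // divr_gt0.
(* This [h] satisfies [2 ^ h > h > 1 / eps]. *)
exists K => // eps eps0; pose h := (Num.truncn eps^-1).+1.
have heps : 2^-1 ^+ h < eps.
  rewrite exprVn -[ltRHS]invrK ltf_pV2 ?posrE ?invr_gt0 ?exprn_gt0 //.
  apply: (lt_trans (truncnS_gt _)); rewrite -natrX ltr_nat; exact: ltn_expl.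
pose Lambda : R := 8 + h.+1%:R * (8 * 2 ^+ h).
(* Three lower bounds on [n] are used: 3 for a cycle, [exp Lambda] for the cost of the last rounds,
   [4 * K ^ 2] for an edge probability at most 1. *)
near=> n => col c colE cE.
have n3 : (2 < n)%N.
  rewrite -(ltr_nat R) (lt_le_trans (_ : 2 < 3%:R)) ?ltr_nat //.
  by near: n; exact: nbhs_infty_ger.
have n0 : 0 < n%:R :> R by rewrite ltr0n (ltn_trans _ n3).
have lnn : Lambda <= ln n%:R.
  rewrite -[leLHS]expRK ler_ln ?posrE ?expR_gt0 //.
  by near: n; exact: nbhs_infty_ger.
have p1 : K * ln n%:R / n%:R <= 1.
  rewrite ler_pdivrMr // mul1r; apply: mul_ln_le => //.
  by near: n; exact: nbhs_infty_ger.
have count_eq j : #|color_class col j| = count_mem j c.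
  by apply/eqP; rewrite -(eqr_nat R) colE cE.
have bc j : b * n%:R <= (count_mem j c)%:R.
  by rewrite cE ler_wpM2r // bigmin_le.
have /andP[lo up] := gnp_prob_failure n3 b0 b1 count_eq bc lnn (lexx _) p1.
by rewrite ler0_norm ?subr_le0 //; lra.
Unshelve. all: by end_near. Qed.
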